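(* Let $\kappa=(k_0,k_1,k_2,\ldots)$ be a sequence of positive integers, and let $T(\kappa)$ be the rooted tree in which the root has degree $k_0$ and, for each $n\geq 1$, every vertex at level $n$ (i.e. at distance $n$ from the root) has degree $k_n+1$. Suppose that there exists a constant $C>0$ such that $k_n\leq Ck_{n+1}$ for any $n\in\mathbb N$. Then $T(\kappa)$ is approximately uniformly locally finite (AULF).
   Context: All graphs are simple (no loops or multiple edges) and locally finite (every vertex has finitely many adjacent vertices). For a graph $\Gamma$ with vertex set $V$, $d(v)$ is the degree of $v\in V$, $v\sim w$ means that $v$ and $w$ are adjacent, and $l^2(\Gamma)$ is the Hilbert space of square-summable complex functions on $V$, with orthonormal basis $\{\delta_v\}_{v\in V}$ of characteristic functions of vertices (the standard basis). The normalized Laplacian $L$ of $\Gamma$ is the bounded operator on $l^2(\Gamma)$ given by $Lf(v)=f(v)-\sum_{w\sim v}\frac{1}{\sqrt{d(v)d(w)}}f(w)$. For $d\in\mathbb N$, $\mathbb B^{(d)}$ is the set of bounded operators on $l^2(\Gamma)$ whose matrix with respect to the standard basis has at most $d$ non-zero entries in each row and in each column. Put $\mathbb B^{(\infty)}=\bigcup_{d\in\mathbb N}\mathbb B^{(d)}$ and let $\mathbb B$ be the closure of $\mathbb B^{(\infty)}$ in the operator norm. The graph $\Gamma$ is approximately uniformly locally finite (AULF) if $L\in\mathbb B$. *)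

(* Defs.v *)
From HB Require Import structures.
From mathcomp Require Import all_boot all_order all_algebra.
From mathcomp Require Import finmap.
From mathcomp Require Import all_classical all_reals.
From mathcomp Require Import ereal esum.
From mathcomp Require Import complex.
From mathcomp Require Import ring lra.

Set Implicit Arguments.
Unset Strict Implicit.
Unset Printing Implicit Defensive.

Import Order.TTheory GRing.Theory Num.Theory.
Import ComplexField.Normc.

Local Open Scope classical_set_scope.
Local Open Scope ring_scope.
Local Open Scope complex_scope.

Record lfgraph := LFGraph {
  vertex :> choiceType;
  adj : rel vertex;
  adj_sym : symmetric adj;
  adj_irr : irreflexive adj;
  adj_fin : forall v, finite_set [set w | adj v w] }.

Section Graph.
Variable G : lfgraph.
Implicit Types (u v w : G) (p c : seq G).

Definition nbh v : set G := [set w | adj v w].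

Definition deg v : nat := #|` fset_set (nbh v)|%fset.

Definition walk u p v : bool := path (@adj G) u p && (last u p == v).

Definition connected_graph : Prop := forall u v, exists p, walk u p v.

Definition acyclic_graph : Prop :=
  forall c, (2 < size c)%N -> ~ ucycle (@adj G) c.

Definition is_tree : Prop := connected_graph /\ acyclic_graph.

Definition at_dist u v (n : nat) : Prop :=
  (exists2 p, walk u p v & size p = n) /\
  (forall p, walk u p v -> (n <= size p)%N).

(* T(k) is only determined up to isomorphism: is_T k o says that G, rooted at
   o, is a realisation of it. *)
Definition is_T (k : nat -> nat) (o : G) : Prop :=
  [/\ is_tree, deg o = k 0%N &
      forall n v, (0 < n)%N -> at_dist o v n -> deg v = (k n).+1].

End Graph.

Section SquaredModulus.
Variable R : rcfType.
Implicit Types (x y z : R[i]) (a : R).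

Lemma sqr_normcE z : normc z ^+ 2 = complex.Re z ^+ 2 + complex.Im z ^+ 2.
Proof. by case: z => a b /=; rewrite sqr_sqrtr// addr_ge0// sqr_ge0. Qed.

Lemma sqr_normcD x y :
  normc (x + y) ^+ 2 <= 2 * normc x ^+ 2 + 2 * normc y ^+ 2.
Proof.
rewrite !sqr_normcE; case: x => a b; case: y => c d /=.
by have := sqr_ge0 (a - c); have := sqr_ge0 (b - d); nra.
Qed.

Lemma sqr_normcN z : normc (- z) ^+ 2 = normc z ^+ 2.
Proof. by rewrite !sqr_normcE; case: z => a b /=; rewrite !sqrrN. Qed.

Lemma sqr_normcZ a z : normc (a%:C * z) ^+ 2 = a ^+ 2 * normc z ^+ 2.
Proof. by rewrite !sqr_normcE; case: z => b c /=; ring. Qed.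

Lemma sqr_normc_sum (T : Type) (s : seq T) (F : T -> R[i]) :
  normc (\sum_(i <- s) F i) ^+ 2 <=
    (size s)%:R * \sum_(i <- s) normc (F i) ^+ 2.
Proof.
elim: s => [|t s IHs]; first by rewrite !big_nil normc0 expr0n mul0r.
have cross : 2 * (complex.Re (F t) * complex.Re (\sum_(i <- s) F i) +
                  complex.Im (F t) * complex.Im (\sum_(i <- s) F i)) <=
    (size s)%:R * normc (F t) ^+ 2 + \sum_(i <- s) normc (F i) ^+ 2.
  elim: s {IHs} => [|u s IHs]; first by rewrite !big_nil /=; lra.
  rewrite !big_cons /= -natr1.
  move: IHs; rewrite [normc (F u) ^+ 2]sqr_normcE.
  move: (\sum_(_ <- _) normc _ ^+ 2) => Q.
  move: (\sum_(_ <- _) F _) => S.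
  have := sqr_normcE (F t); move: (normc (F t) ^+ 2) => N ->.
  case: (F t) => a b; case: (F u) => c d; case: S => e f /=.
  have := sqr_ge0 (a - c); have := sqr_ge0 (b - d).
  by move=> h1 h2 h3; nra.
rewrite !big_cons /= -natr1.
have h : normc (F t + \sum_(j <- s) F j) ^+ 2 =
    normc (F t) ^+ 2 + 2 * (complex.Re (F t) * complex.Re (\sum_(i <- s) F i) +
      complex.Im (F t) * complex.Im (\sum_(i <- s) F i)) + normc (\sum_(j <- s) F j) ^+ 2.
  rewrite !sqr_normcE; case: (F t) => a b.
  by case: (\sum_(i <- s) F i) => c d /=; ring.
rewrite h; lra.
Qed.

End SquaredModulus.

Section L2.
Variables (R : realType) (G : lfgraph).
Implicit Types f g : G -> R[i].

Definition sqsum f : \bar R := (\esum_(v in [set: G]) (normc (f v) ^+ 2)%:E)%E.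

Lemma sqsum_ge0 f : (0 <= sqsum f)%E.
Proof. by apply: esum_ge0 => v _; rewrite lee_fin sqr_ge0. Qed.

Lemma sqsum_le (c : R) f (a : G -> \bar R) : 0 <= c ->
  (forall v, ((normc (f v) ^+ 2)%R%:E <= c%:E * a v)%E) ->
  (forall v, (0 <= a v)%E) ->
  (sqsum f <= c%:E * \esum_(v in [set: G]) a v)%E.
Proof.
move=> c0 fa a0; apply: ge_ereal_sup => _ [A [finA _]] <-.
apply: (@le_trans _ _ (\sum_(v \in A) c%:E * a v)%E).
  by apply: lee_fsum.
rewrite -ge0_mule_fsumr//; apply: lee_wpmul2l; first by rewrite lee_fin.
by apply: esum_ge; exists A.
Qed.

Lemma sqsumD f g : (sqsum (f + g)%R <= 2%:E * (sqsum f + sqsum g))%E.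
Proof.
rewrite /sqsum -esumD; [|by move=> v _; rewrite lee_fin sqr_ge0..].
apply: sqsum_le => // v.
  by rewrite -EFinD -EFinM lee_fin mulrDr; exact: sqr_normcD.
by rewrite -EFinD lee_fin addr_ge0// sqr_ge0.
Qed.

Lemma sqsumZ (c : R[i]) f : (sqsum (c *: f)%R <= (normc c ^+ 2)%R%:E * sqsum f)%E.
Proof.
apply: sqsum_le => [|v|v]; rewrite ?sqr_ge0//.
  by rewrite -EFinM lee_fin -exprMn -normcM.
by rewrite lee_fin sqr_ge0.
Qed.

Definition l2_pred : {pred G -> R[i]} := fun f => (sqsum f < +oo)%E.

Lemma l2_predE f : (f \in l2_pred) = (sqsum f < +oo)%E.
Proof. by []. Qed.

Lemma l2_pred_submod_closed : submod_closed l2_pred.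
Proof.
split=> [|c f g]; rewrite !l2_predE; last move=> f_l2 g_l2.
  rewrite /sqsum esum1 ?ltry// => v _.
  by rewrite (_ : (0 : G -> R[i]) v = 0)// normc0 expr0n.
apply: le_lt_trans (sqsumD _ _) _; apply: lte_mul_pinfty => //.
apply: lte_add_pinfty => //; apply: le_lt_trans (sqsumZ _ _) _.
by apply: lte_mul_pinfty => //; rewrite lee_fin sqr_ge0.
Qed.

HB.instance Definition _ :=
  GRing.isSubmodClosed.Build _ _ l2_pred l2_pred_submod_closed.

Record l2 : Type := L2 { l2_fun :> G -> R[i]; l2_funP : l2_fun \in l2_pred }.

HB.instance Definition _ := [isSub for l2_fun].
HB.instance Definition _ := [Choice of l2 by <:].
HB.instance Definition _ := [SubChoice_isSubLmodule of l2 by <:].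

Definition l2norm (f : l2) : R := Num.sqrt (fine (sqsum f)).

Lemma delta_l2 v : (fun w : G => (w == v)%:R : R[i]) \in l2_pred.
Proof.
rewrite l2_predE /sqsum (esumID [set v])//=; last first.
  by move=> w _; rewrite lee_fin sqr_ge0.
rewrite setTI esum_set1 ?lee_fin ?sqr_ge0// esum1 ?adde0 ?ltry// => w.
by move=> [_ /= /eqP/negbTE ->]; rewrite normc0 expr0n.
Qed.

Definition delta v : l2 := L2 (delta_l2 v).

Implicit Types S T : {linear l2 -> l2}.

Definition bounded_op T : Prop :=
  exists M : R, forall f : l2, l2norm (T f) <= M * l2norm f.

(* Only meaningful on bounded operators: [sup] of an unbounded set is 0. *)
Definition opnorm (A : l2 -> l2) : R :=
  sup [set l2norm (A f) | f in [set f : l2 | l2norm f <= 1]].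

(* The matrix coefficient <T delta_w, delta_v>. *)
Definition entry T (v w : G) : R[i] := T (delta w) v.

Definition B_ (d : nat) : set {linear l2 -> l2} :=
  [set T | [/\ bounded_op T,
    forall v, ([set w | entry T v w != 0] #<= `I_d)%card &
    forall w, ([set v | entry T v w != 0] #<= `I_d)%card]].

Definition B_oo : set {linear l2 -> l2} := \bigcup_d B_ d.

(* Closure of B_oo in the bounded operators, for the operator norm. *)
Definition BB : set {linear l2 -> l2} :=
  [set T | bounded_op T /\
    forall e : R, 0 < e -> exists2 S, B_oo S & opnorm (T \- S) < e].

Definition nbh_sum f : G -> R[i] := fun v =>
  \sum_(w \in nbh v) ((Num.sqrt ((deg v)%:R * (deg w)%:R : R))^-1)%:C * f w.

Definition lap_fun f : G -> R[i] := fun v => f v - nbh_sum f v.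

Lemma nbh_sumE f v : nbh_sum f v = \sum_(w <- fset_set (nbh v))
  ((Num.sqrt ((deg v)%:R * (deg w)%:R : R))^-1)%:C * f w.
Proof. by rewrite /nbh_sum fsbig_finite//; exact: adj_fin. Qed.

Lemma in_nbh (v w : G) : (w \in fset_set (nbh v)) = adj v w.
Proof.
rewrite in_fset_set; last exact: adj_fin.
by apply/idP/idP; rewrite inE.
Qed.

Lemma deg_gt0 (v w : G) : adj v w -> (0 < deg v)%N.
Proof. by move=> vw; rewrite cardfs_gt0; apply/fset0Pn; exists w; rewrite in_nbh. Qed.

Lemma sqsum_nbh f : (sqsum (nbh_sum f) <= sqsum f)%E.
Proof.
pose a w : \bar R := ((deg w)%:R^-1 * normc (f w) ^+ 2)%:E.
have a0 w : (0 <= a w)%E by rewrite lee_fin mulr_ge0 ?sqr_ge0// invr_ge0.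
apply: (@le_trans _ _
    (\esum_(v in [set: G]) \esum_(w in nbh v) a w)%E).
  rewrite /sqsum; apply: le_esum => v _.
  rewrite esum_fset//; last exact: adj_fin.
  rewrite fsbig_finite/=; last exact: adj_fin.
  rewrite nbh_sumE sumEFin lee_fin.
  apply: le_trans (sqr_normc_sum _ _) _.
  rewrite mulr_sumr big_seq [leRHS]big_seq.
  apply: ler_sum => w; rewrite in_nbh => vw.
  have wv : adj w v by rewrite adj_sym.
  have dv := deg_gt0 vw; have dw := deg_gt0 wv.
  rewrite sqr_normcZ exprVn sqr_sqrtr ?mulr_ge0// mulrA.
  apply: ler_wpM2r; first exact: sqr_ge0.
  rewrite -/(deg v) invfM mulrA divff ?mul1r//.
  by rewrite pnatr_eq0 -lt0n.
rewrite esum_esum//.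
rewrite (@reindex_esum R _ _ ([set: G] `*`` (@nbh G)) _ (fun x => (x.2, x.1))).
  rewrite -(@esum_esum R _ _ _ _ (fun w _ => a w))//.
  apply: le_esum => w _; rewrite esum_fset//; last exact: adj_fin.
  rewrite fsbig_finite/=; last exact: adj_fin.
  rewrite sumEFin lee_fin big_const_seq count_predT iter_addr_0 -/(deg w).
  rewrite -mulrnAl -[_ *+ deg w]mulr_natr.
  have [->|dw] := eqVneq (deg w) 0%N; first by rewrite mulr0 mul0r sqr_ge0.
  by rewrite mulVf ?mul1r// pnatr_eq0.
split=> [[v w] [_ /= vw]|[v w] [v' w'] _ _ [-> ->]//|[v w] [_ /= vw]].
  by split=> //=; rewrite /nbh/= adj_sym.
by exists (w, v) => //; split=> //=; rewrite /nbh/= adj_sym.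
Qed.

Lemma sqsum_lap f : (sqsum (lap_fun f) <= 4%:E * sqsum f)%E.
Proof.
apply: le_trans (sqsumD _ (fun v => - nbh_sum f v)) _.
rewrite (_ : (4 : R) = 2 * 2); last by ring.
rewrite EFinM -muleA; apply: lee_wpmul2l => //.
rewrite (_ : 2%:E = (1 + 1)%:E :> \bar R)//.
rewrite EFinD ge0_muleDl// mul1e; apply: leeD => //.
apply: le_trans (sqsum_nbh f).
by rewrite /sqsum; apply: le_esum => v _; rewrite sqr_normcN.
Qed.

Lemma lap_l2 (f : l2) : lap_fun f \in l2_pred.
Proof.
have := l2_funP f; rewrite !l2_predE => f_l2.
by apply: le_lt_trans (sqsum_lap f) _; apply: lte_mul_pinfty.
Qed.

Definition laplacian (f : l2) : l2 := L2 (lap_l2 f).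

Lemma laplacian_is_linear : linear laplacian.
Proof.
move=> c f g; apply/val_inj/funext => v.
change (lap_fun (fun w => c * f w + g w) v = c * lap_fun f v + lap_fun g v).
rewrite /lap_fun !nbh_sumE mulrBr mulr_sumr addrACA -opprD.
congr (_ - _); rewrite -big_split /=; apply: eq_bigr => w _.
by rewrite mulrDr mulrCA.
Qed.

HB.instance Definition _ :=
  GRing.isLinear.Build R[i] l2 l2 _ laplacian laplacian_is_linear.

Lemma laplacian_bounded : bounded_op laplacian.
Proof.
exists 2 => /= f; rewrite /l2norm.
have ->: 2 = Num.sqrt 4 :> R.
  by rewrite (_ : 4 = 2 ^+ 2) ?sqrtr_sqr ?ger0_norm//; ring.
rewrite -sqrtrM//; apply: ler_wsqrtr.
have fin (g : l2) : sqsum g \is a fin_num.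
  by rewrite ge0_fin_numE ?sqsum_ge0//; have := l2_funP g; rewrite l2_predE.
have := sqsum_lap f.
rewrite -(fineK (fin f)) -(fineK (fin (laplacian f))) -EFinM lee_fin.
by rewrite fineK.
Qed.

Definition AULF : Prop := BB laplacian.

End L2.

(* Main.v *)
Require Import Defs.
From HB Require Import structures.
From mathcomp Require Import all_boot all_order all_algebra.
From mathcomp Require Import finmap.
From mathcomp Require Import all_classical all_reals.
From mathcomp Require Import ereal esum complex ring lra.

Import Order.TTheory GRing.Theory Num.Theory.
Import ComplexField.Normc.

Set Implicit Arguments.
Unset Strict Implicit.
Unset Printing Implicit Defensive.

Local Open Scope ring_scope.

(** The Laplacian is 1 - A, where A has the entry 1/sqrt(d(v)d(w)) at each pair
    of adjacent vertices. Given D, keep only the entries of A between two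
    vertices of degree at most D, and let S = 1 - (what is kept). A row or
    column of S has at most D + 1 non-zero entries, and L - S consists of the
    entries of A on the edges that have an end of degree above D. It remains to
    see that this rest is small in norm when D is large.

    In T(k), an edge joins a parent v at some level n to a child w at level n +
    1, and d(v) <= k_n + 1 <= 2 k_n <= 2 C k_(n+1) <= 2 C d(w). So the degree of
    the child is at least of order D / C on every discarded edge, even when it
    is the parent that has the large degree. Split the rest into its
    parent-to-child part and its child-to-parent part. In the first, the
    children of v form a block consisting of a single row of d(v) entries or
    fewer, each 1/sqrt(d(v)d(w)); blocks of different v involve disjoint sets of
    children, so the squared norm of this part is at most the maximum of 1/d(w),
    hence of order C / D. The second part is the transpose of the first one.
    Both are handled by one estimate, [sqsum_cut]: a set of entries of A in
    which every entry lies in a row with r and a column with c entries such that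
    r c <= b d(v) d(w) has squared norm at most b.

    The analytic half, [AULF_orientation], uses only that the edges can be
    oriented so that a vertex has at most one parent and that d(parent) <= C
    d(child). The combinatorial half finds this orientation in a tree, from the
    distance to the root: [acyclic_nbr_inj] gives the uniqueness of the parent,
    and [tree_adj_level] that no edge joins vertices of the same level. *)

(** * Levels in a rooted tree *)

Section Distance.
Variable G : lfgraph.
Implicit Types u v w o : G.

Lemma connected_at_dist o : connected_graph G ->
  forall v, exists n, at_dist o v n.
Proof.
move=> conG v; have [p0 p0P] := conG o v.
pose P n := `[< exists2 p, walk o p v & size p = n >].
have exP : exists n, P n by exists (size p0); apply/asboolP; exists p0.
case: (ex_minnP exP) => n /asboolP nP n_min; exists n; split=> // p pP.
by apply: n_min; apply/asboolP; exists p.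
Qed.

Lemma at_dist_inj o v m n : at_dist o v m -> at_dist o v n -> m = n.
Proof.
move=> [[p pP <-] p_min] [[q qP <-] q_min].
by apply/eqP; rewrite eqn_leq p_min// q_min.
Qed.

Lemma at_dist0 o v : at_dist o v 0 -> v = o.
Proof. by move=> [[[|//] /andP[_ /eqP]]]. Qed.

Lemma at_dist_adj o v w m n :
  at_dist o v m -> at_dist o w n -> adj v w -> (n <= m.+1)%N.
Proof.
move=> [[p /andP[pP /eqP pv] <-] _] [_ n_min] vw.
rewrite -(size_rcons p w); apply: n_min.
by rewrite /walk rcons_path last_rcons pP pv vw eqxx.
Qed.

Lemma at_distS o v n : at_dist o v n.+1 ->
  exists u m, [/\ at_dist o u m, adj u v & (m <= n)%N].
Proof.
move=> [[p]]; case/lastP: p => [//|p x]; rewrite size_rcons => xP [pn] v_min.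
move: xP; rewrite /walk rcons_path last_rcons => /andP[/andP[pP px] /eqP xv].
have pw : walk o p (last o p) by rewrite /walk pP eqxx.
have u_min q : walk o q (last o p) -> (n <= size q)%N.
  move=> /andP[qP /eqP ql]; rewrite -ltnS -(size_rcons q v); apply: v_min.
  by rewrite /walk rcons_path last_rcons qP ql -xv px eqxx.
by exists (last o p), n; split; [split=> //; exists p | rewrite -xv |].
Qed.

Definition avoid v : rel G := fun x y => [&& adj x y, x != v & y != v].

(** A geodesic from o through v would reach v before its end w, so w would be
    further from o than v. *)
Lemma geodesic_avoid o v w m n p : at_dist o v n -> (m <= n)%N -> w != v ->
  walk o p w -> size p = m -> path (avoid v) o p.
Proof.
move=> [_ v_min] mn wv /andP[pP /eqP pw] pm.
have v_notin : v \notin o :: p.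
  apply/negP => v_in.
  case/splitPl: p / v_in pP pw pm => p1 p2 p1v.
  rewrite cat_path => /andP[p1P _]; rewrite last_cat p1v size_cat => p2w.
  have : (n <= size p1)%N by apply: v_min; rewrite /walk p1P p1v eqxx.
  case: p2 p2w => [/= vw|y p2 _ /= h]; first by rewrite vw eqxx in wv.
  move=> pm; move: mn; rewrite -pm leqNgt => /negP; apply.
  by rewrite addnS ltnS (leq_trans h)// leq_addr.
elim: p o pP v_notin {pw pm v_min} => //= y p IHp o /andP[oy yp].
rewrite inE negb_or => /andP[vo v_notin].
rewrite IHp// andbT /avoid oy eq_sym vo.
by move: v_notin; rewrite inE negb_or eq_sym => /andP[].
Qed.

(** Geodesics from w and w' to o avoid v, so w and w' are joined by a path that
    avoids v; if they were distinct, this path would close up to a cycle through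
    v. This says at once that a vertex has at most one parent and, as one of m
    and m' may be equal to n, that a vertex with a parent has no neighbour of
    its own level. *)
Lemma acyclic_nbr_inj o v w w' n m m' : acyclic_graph G ->
  at_dist o v n -> at_dist o w m -> at_dist o w' m' ->
  adj v w -> adj v w' -> (m <= n)%N -> (m' <= n)%N -> w = w'.
Proof.
move=> acG vn wm w'm' vw vw' mn m'n; apply/eqP/negPn/negP => ww'.
have neq x : adj v x -> x != v.
  by move=> vx; apply/eqP => xv; rewrite xv adj_irr in vx.
have [[p pP pm] _] := wm; have [[p' p'P p'm] _] := w'm'.
have ap := geodesic_avoid vn mn (neq _ vw) pP pm.
have ap' := geodesic_avoid vn m'n (neq _ vw') p'P p'm.
move/andP: pP => [_ /eqP pw]; move/andP: p'P => [_ /eqP p'w'].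
have aC : avoid v =2 (fun x y => avoid v y x).
  by move=> x y; rewrite /avoid adj_sym [(x != v) && _]andbC.
(* From w back to o along p, then on to w' along p'. *)
pose q := rev (belast o p) ++ p'.
have lq : last w (rev (belast o p)) = o.
  by case: (p) pw => [/= ->//|y s _]; rewrite /= rev_cons last_rcons.
have qP : path (avoid v) w q.
  by rewrite cat_path lq ap' andbT -pw rev_path -(eq_path aC).
have qw' : last w q = w' by rewrite last_cat lq.
case/shortenP: qP qw' => s sP sU _ sw'.
have s0 : (0 < size s)%N by case: (s) sw' ww' => //= ->; rewrite eqxx.
have vs : v \notin w :: s.
  rewrite inE negb_or eq_sym neq//=.
  elim: s (w) sP {sU sw' s0} => //= y s IHs x.
  by move=> /andP[/and3P[_ _ yv] /IHs]; rewrite inE negb_or eq_sym yv.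
apply: (acG [:: v, w & s]) => //; apply/andP; split; last first.
  by rewrite cons_uniq vs.
rewrite /= vw /= rcons_path sw' [adj w' v]adj_sym vw' andbT.
by apply: sub_path sP => x y /and3P[].
Qed.

Lemma tree_adj_level o v w m n : is_tree G ->
  at_dist o v m -> at_dist o w n -> adj v w -> m != n.
Proof.
move=> [conG acG] vm wn vw; apply/eqP => mn; rewrite -{n}mn in wn.
case: m vm wn => [|m] vm wn.
  by move: vw; rewrite (at_dist0 vm) (at_dist0 wn) adj_irr.
(* The last step of a geodesic to v comes from a neighbour u of lower level,
   which would have to coincide with w. *)
have [u [l [ul uv lm]]] := at_distS vm.
have uw : u = w.
  by apply: (acyclic_nbr_inj acG vm ul wn) => //; rewrite 1?adj_sym// ltnW.
by move: lm; rewrite uw in ul; rewrite (at_dist_inj ul wn) ltnn.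
Qed.

End Distance.

(** * Parts of the normalized adjacency operator *)

Lemma count_le1 (T : eqType) (s : seq T) (P : pred T) : uniq s ->
  {in s &, forall x y, P x -> P y -> x = y} -> (count P s <= 1)%N.
Proof.
move=> s_uniq P_inj; rewrite -size_filter.
case Ps : [seq x <- s | P x] => [|x [|y t]]//=.
have := filter_uniq P s_uniq; rewrite Ps /= inE negb_or.
move=> /andP[/andP[/eqP xy _] _].
have [] : (P x && (x \in s)) /\ (P y && (y \in s)).
  by rewrite -!mem_filter Ps !inE !eqxx orbT.
by move=> /andP[Px xs] /andP[Py ys]; case: xy; exact: P_inj.
Qed.

Section Cut.
Variables (R : realType) (G : lfgraph).
Implicit Types (v w : G) (f : l2 R G) (r : rel G).

Lemma exchange_esum_nbh (F : G -> G -> \bar R) :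
  (forall v w, (0 <= F v w)%E) ->
  (\esum_(v in [set: G]) \esum_(w in nbh v) F v w =
   \esum_(w in [set: G]) \esum_(v in nbh w) F v w)%E.
Proof.
move=> F0; rewrite esum_esum// [RHS]esum_esum//.
rewrite (@reindex_esum R _ _ (([set: G] `*`` (@nbh G))%classic) _
  (fun x => (x.2, x.1)))//.
split=> [[v w] [_ /= vw]|[v w] [v' w'] _ _ [-> ->]//|[v w] [_ /= vw]].
  by split=> //=; rewrite /nbh/= adj_sym.
by exists (w, v) => //; split=> //=; rewrite /nbh/= adj_sym.
Qed.

Definition coef v w : R := (Num.sqrt ((deg v)%:R * (deg w)%:R))^-1.

(** The normalized adjacency operator with only the matrix entries at the pairs
    in r. *)
Definition cut_fun r (f : G -> R[i]) : G -> R[i] := fun v =>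
  \sum_(w <- fset_set (nbh v) | r v w) (coef v w)%:C%C * f w.

Definition row_count r v : nat := count (r v) (fset_set (nbh v)).

Definition col_count r w : nat := count (r^~ w) (fset_set (nbh w)).

Lemma row_count_le_deg r v : (row_count r v <= deg v)%N.
Proof. exact: count_size. Qed.

Lemma col_count_le_deg r w : (col_count r w <= deg w)%N.
Proof. exact: count_size. Qed.

(** By Cauchy-Schwarz in row v, the squared modulus of the value at v is at most
    the row count of v times the sum of |f w|^2 / (d(v) d(w)). After the
    exchange of the two sums, |f w|^2 gets a coefficient with one summand for
    each of the entries of column w, each at most c divided by their number. *)
Lemma sqsum_cut r (c : R) f : 0 <= c ->
  (forall v w, adj v w -> r v w ->
     (row_count r v * col_count r w)%:R <= c * ((deg v)%:R * (deg w)%:R)) ->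
  (sqsum (cut_fun r f) <= c%:E * sqsum f)%E.
Proof.
move=> c0 rc.
(* The w-th term of the Cauchy-Schwarz bound in row v. *)
pose F v w : R := if r v w then
  (row_count r v)%:R * ((deg v)%:R * (deg w)%:R)^-1 * normc (f w) ^+ 2 else 0.
have F0 v w : 0 <= F v w.
  rewrite /F; case: ifP => // _; apply: mulr_ge0; last exact: sqr_ge0.
  by rewrite mulr_ge0// invr_ge0 mulr_ge0.
apply: (@le_trans _ _
  (\esum_(v in [set: G]) \esum_(w in nbh v) (F v w)%:E)%E).
  apply: le_esum => v _.
  rewrite esum_fset; [|exact: adj_fin|by move=> *; rewrite lee_fin].
  rewrite fsbig_finite/=; last exact: adj_fin.
  rewrite sumEFin lee_fin /F -big_mkcond /cut_fun -[X in normc X]big_filter.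
  apply: le_trans (sqr_normc_sum _ _) _.
  rewrite size_filter -/(row_count r v) big_filter mulr_sumr.
  apply: ler_sum => w _.
  by rewrite sqr_normcZ exprVn sqr_sqrtr ?mulr_ge0// mulrA.
rewrite exchange_esum_nbh; last by move=> *; rewrite lee_fin.
(* The factor c is absorbed in f, so that [sqsumZ] takes it out of the sum. *)
have c_sqr : c = normc (Num.sqrt c)%:C%C ^+ 2.
  by rewrite sqr_normcE /= expr0n addr0 sqr_sqrtr.
rewrite c_sqr; apply: le_trans (sqsumZ _ _).
apply: le_esum => w _; rewrite esum_fset; last 2 first.
- exact: adj_fin.
- by move=> *; rewrite lee_fin.
rewrite fsbig_finite/=; last exact: adj_fin.
rewrite sumEFin lee_fin /F -big_mkcond -mulr_suml normcM exprMn -c_sqr.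
apply: ler_wpM2r; first exact: sqr_ge0.
(* If column w is empty then so is the sum, and the value 0 of the quotient by 0
   does no harm. *)
apply: (@le_trans _ _ (
  \sum_(v <- fset_set (nbh w) | r v w) c / (col_count r w)%:R)).
  rewrite big_seq_cond [leRHS]big_seq_cond; apply: ler_sum => v.
  rewrite in_nbh => /andP[wv rvw].
  have vw : adj v w by rewrite adj_sym.
  have dv := deg_gt0 vw; have dw := deg_gt0 wv.
  have cw : (0 < col_count r w)%N.
    by rewrite -has_count; apply/hasP; exists v; rewrite ?in_nbh.
  rewrite ler_pdivrMr ?mulr_gt0 ?ltr0n// mulrAC ler_pdivlMr ?ltr0n//.
  by have := rc _ _ vw rvw; rewrite natrM.
rewrite big_const_seq iter_addr_0 -/(col_count r w) -[leLHS]mulr_natr.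
have [->|cw] := eqVneq (col_count r w) 0%N; first by rewrite mulr0.
by rewrite divfK// pnatr_eq0.
Qed.

Lemma sqsum_cut_le r f : (sqsum (cut_fun r f) <= sqsum f)%E.
Proof.
rewrite -[leRHS]mul1e; apply: sqsum_cut => // v w _ _.
by rewrite mul1r -natrM ler_nat leq_mul ?row_count_le_deg ?col_count_le_deg.
Qed.

Lemma cut_l2 r (f : l2 R G) : cut_fun r f \in @l2_pred R G.
Proof.
have := l2_funP f; rewrite !l2_predE; exact: le_lt_trans (sqsum_cut_le _ _).
Qed.

Definition cut r (f : l2 R G) : l2 R G := L2 (cut_l2 r f).

Lemma cut_is_linear r : linear (cut r).
Proof.
move=> c f g; apply/val_inj/funext => v.
change (cut_fun r (fun w => c * f w + g w) v =
        c * cut_fun r f v + cut_fun r g v).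
rewrite /cut_fun mulr_sumr -big_split /=; apply: eq_bigr => w _.
by rewrite mulrDr mulrCA.
Qed.

HB.instance Definition _ r :=
  GRing.isLinear.Build R[i] (l2 R G) (l2 R G) _ (cut r) (cut_is_linear r).

(** * Banded approximations of the Laplacian *)

Definition cut_laplacian r : {linear l2 R G -> l2 R G} := idfun \- cut r.

Lemma l2norm_le (b : R) (f g : l2 R G) : 0 <= b ->
  (sqsum g <= (b ^+ 2)%:E * sqsum f)%E -> l2norm g <= b * l2norm f.
Proof.
move=> b0; have fin (h : l2 R G) : sqsum h \is a fin_num.
  by rewrite ge0_fin_numE ?sqsum_ge0//; have := l2_funP h; rewrite l2_predE.
rewrite -(fineK (fin f)) -(fineK (fin g)) -EFinM lee_fin => gf.
rewrite /l2norm -(ger0_norm b0) -sqrtr_sqr -sqrtrM ?sqr_ge0//.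
exact: ler_wsqrtr.
Qed.

Lemma opnorm_le (b : R) (A : l2 R G -> l2 R G) : 0 <= b ->
  (forall f, l2norm (A f) <= b * l2norm f) -> opnorm A <= b.
Proof.
move=> b0 Ab; apply: ge_sup.
  exists (l2norm (A 0)), 0 => //=.
  rewrite /l2norm /sqsum esum1 ?sqrtr0// => v _.
  by rewrite (_ : (0 : l2 R G) v = 0)// normc0 expr0n.
move=> _ [f /= f1 <-]; apply: le_trans (Ab f) _.
by rewrite -[leRHS]mulr1 ler_wpM2l.
Qed.

Lemma sqsumN (f : G -> R[i]) : sqsum (- f) = sqsum f.
Proof. by apply: eq_esum => v _; rewrite sqr_normcN. Qed.

Lemma cut_laplacian_bounded r : bounded_op (cut_laplacian r).
Proof.
exists 2 => f; apply: l2norm_le => //.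
apply: le_trans (sqsumD f (- cut r f)) _.
rewrite expr2 EFinM -muleA; apply: lee_wpmul2l => //.
rewrite -[(2 : R)]/(1 + 1 : R) EFinD ge0_muleDl// mul1e leeD2l//.
by rewrite sqsumN; exact: sqsum_cut_le.
Qed.

Lemma entry_cut_laplacian r v w :
  entry (cut_laplacian r) v w != 0 -> v = w \/ adj v w /\ r v w.
Proof.
have -> : entry (cut_laplacian r) v w =
    (v == w)%:R - cut_fun r (fun u => (u == w)%:R) v by [].
have [->|_] := eqVneq v w; first by left.
rewrite sub0r oppr_eq0 => nz; right; apply/andP; apply/negPn/negP.
move=> vw; move: nz; rewrite /cut_fun big_seq_cond big1 ?eqxx// => u.
rewrite in_nbh => vu; have [uw|_] := eqVneq u w; last by rewrite mulr0.
by move: vw; rewrite -uw vu.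
Qed.

Lemma cut_laplacian_B r (d : nat) : symmetric r ->
  (forall v w, r v w -> (deg v <= d)%N) -> B_ d.+1 (cut_laplacian r).
Proof.
move=> r_sym r_deg.
have small v (A : set G) : (A `<=` [set w | v = w \/ adj v w /\ r v w] ->
    A #<= `I_d.+1)%classic%card.
  move=> Ar; pose F := (v |` [fset w in fset_set (nbh v) | r v w])%fset.
  have AF : (A `<=` [set` F])%classic.
    move=> w /Ar /= [<-|[vw rvw]]; first by rewrite !inE eqxx.
    by rewrite !inE /= in_nbh vw rvw orbT.
  apply: card_le_trans (subset_card_le AF) _.
  have /card_eq_fsetP/card_le_eql -> := erefl #|` F|; rewrite card_le_II.
  rewrite cardfsU1 -add1n leq_add ?leq_b1//.
  have [[w rvw]|no_r] := pselect (exists w, r v w); last first.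
    rewrite (_ : [fset w in _ | _]%fset = fset0) ?cardfs0//.
    apply/fsetP => w; rewrite !inE /=; apply/negP => /andP[_ rvw].
    by apply: no_r; exists w.
  apply: leq_trans (r_deg _ _ rvw); apply: fsubset_leq_card.
  by apply/fsubsetP => u; rewrite !inE /= => /andP[].
split=> [|v|w]; first exact: cut_laplacian_bounded.
  by apply: (small v) => w /= /entry_cut_laplacian.
apply: (small w) => v /= /entry_cut_laplacian[->|]; first by left.
by rewrite adj_sym r_sym; right.
Qed.

(** The predicate p splits the difference into two parts that can be estimated
    separately. *)
Lemma laplacian_sub_cut r p (f : l2 R G) :
  l2_fun (laplacian f - cut_laplacian r f) =
  - (cut_fun [rel v w | ~~ r v w && p v w] f +
     cut_fun [rel v w | ~~ r v w && ~~ p v w] f).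
Proof.
apply/funext => v.
change (f v - nbh_sum f v - (f v - cut_fun r f v) =
  - (cut_fun [rel v w | ~~ r v w && p v w] f v +
     cut_fun [rel v w | ~~ r v w && ~~ p v w] f v)).
rewrite nbh_sumE (bigID (r v)) /=.
rewrite [\sum_(_ <- _ | ~~ r v _) _](bigID (p v)) /= /cut_fun.
by rewrite /coef; ring.
Qed.

(** On a discarded edge from a parent v to a child w, 1 <= (C / D) d(w): either
    d(w) > D, and C >= 1 is used, or C d(w) >= d(v) > D. In the parent-to-child
    part, column w has at most one entry, as w has one parent, and row v at most
    d(v); in the other part the roles are exchanged. So each of the two parts
    has squared norm at most C / D, and their sum at most 4 C / D. *)
Lemma AULF_orientation (par : rel G) (C : R) : 1 <= C ->
  (forall v w, adj v w -> par v w || par w v) ->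
  (forall u v w, par u w -> par v w -> u = v) ->
  (forall v w, par v w -> (deg v)%:R <= C * (deg w)%:R) ->
  AULF R G.
Proof.
move=> C1 par_adj par_inj par_deg; split; first exact: laplacian_bounded.
(* D is chosen so that 4 C / D <= (e / 2) ^ 2. *)
move=> e e0; pose D := Num.bound (16 * C / e ^+ 2).
have C0 : 0 < C by lra.
have D_big : 16 * C / e ^+ 2 < D%:R.
  by apply: archi_boundP; rewrite divr_ge0 ?sqr_ge0// mulr_ge0// ltW.
have D0 : 0 < D%:R :> R.
  by apply: le_lt_trans D_big; rewrite divr_ge0 ?sqr_ge0// mulr_ge0// ltW.
pose low : rel G := [rel v w | (deg v <= D)%N && (deg w <= D)%N].
have child v w : par v w -> ~~ low v w -> 1 <= C / D%:R * (deg w)%:R.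
  move=> vw; rewrite mulrAC ler_pdivlMr// mul1r negb_and -!ltnNge.
  case/orP=> [Dv|Dw].
    by apply: le_trans (par_deg _ _ vw); rewrite ler_nat ltnW.
  by rewrite (@le_trans _ _ (deg w)%:R) ?ler_nat 1?ltnW// ler_peMl.
have lowC v w : low v w = low w v by rewrite /low /= andbC.
exists (cut_laplacian low).
  by exists D.+1 => //; apply: cut_laplacian_B => // v w /andP[].
apply: (@le_lt_trans _ _ (e / 2)); last by lra.
apply: opnorm_le => [|f]; first by lra.
apply: l2norm_le; first by lra.
set down := [rel v w | ~~ low v w && par v w].
set up := [rel v w | ~~ low v w && ~~ par v w].
rewrite [leLHS](_ : _ = sqsum (cut_fun down f + cut_fun up f)); last first.
  by rewrite -[RHS]sqsumN -laplacian_sub_cut.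
apply: le_trans (sqsumD _ _) _.
have cD : (sqsum (cut_fun down f) <= (C / D%:R)%:E * sqsum f)%E.
  apply: sqsum_cut => [|v w vw /andP[nlow pvw]].
    by rewrite divr_ge0// ltW.
  apply: (@le_trans _ _ (deg v)%:R).
    rewrite ler_nat -[leqRHS]muln1 leq_mul ?row_count_le_deg//.
    apply: count_le1 => // x y _ _ /andP[_ xw] /andP[_ yw].
    exact: par_inj xw yw.
  by rewrite mulrCA ler_peMr//; exact: child pvw nlow.
have cU : (sqsum (cut_fun up f) <= (C / D%:R)%:E * sqsum f)%E.
  have par_up v w : adj v w -> ~~ par v w -> par w v.
    by move=> /par_adj/orP[->|].
  apply: sqsum_cut => [|v w vw /andP[nlow pvw]].
    by rewrite divr_ge0// ltW.
  apply: (@le_trans _ _ (deg w)%:R).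
    rewrite ler_nat -[leqRHS]mul1n leq_mul ?col_count_le_deg//.
    apply: count_le1 => // x y; rewrite !in_nbh.
    move=> vx vy /andP[_ xw] /andP[_ yw].
    exact: par_inj (par_up _ _ vx xw) (par_up _ _ vy yw).
  rewrite mulrA ler_peMl//; apply: (child w); first exact: par_up.
  by rewrite lowC.
apply: (@le_trans _ _ (2%:E *
  ((C / D%:R)%:E * sqsum f + (C / D%:R)%:E * sqsum f)))%E.
  by apply: lee_wpmul2l => //; exact: leeD.
have CD0 : (0 <= (C / D%:R)%:E)%E by rewrite lee_fin divr_ge0// ltW.
rewrite -ge0_muleDl// muleA -EFinD -EFinM.
apply: lee_wpmul2r; first exact: sqsum_ge0.
rewrite lee_fin; move: D_big; rewrite ltr_pdivrMr ?exprn_gt0// => D_big.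
rewrite (_ : 2 * _ = 4 * C / D%:R); last first.
  by rewrite -mulrDl mulrA; congr (_ / _); lra.
by rewrite ler_pdivrMr// expr_div_n; lra.
Qed.

End Cut.

Unset Implicit Arguments.

Theorem proposition9 (R : realType) (k : nat -> nat) (G : lfgraph) (o : G)
    (k_gt0 : forall n : nat, (0 < k n)%N)
    (G_is_T : is_T k o)
    (k_growth : exists2 C : R, 0 < C &
       forall n : nat, (k n)%:R <= C * (k n.+1)%:R) :
  AULF R G.
Proof.
case: G_is_T => G_tree deg_o deg_v; case: k_growth => C C0 kC.
have [conG acG] := G_tree.
have [lev levP] := choice (connected_at_dist o conG).
have degE v : (k (lev v) <= deg v <= (k (lev v)).+1)%N.
  have := levP v; case: (lev v) => [|n] vn; last first.
    by rewrite (deg_v n.+1)// leqnn leqnSn.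
  by rewrite (at_dist0 vn) deg_o leqnn leqnSn.
(* The constant 2 C comes from d(v) <= k_n + 1 <= 2 k_n; adding 1 makes it at
   least 1. *)
apply: (@AULF_orientation R G
  [rel v w | adj v w && (lev v < lev w)%N] (2 * C + 1)).
- lra.
- move=> v w vw /=; rewrite vw adj_sym vw/= -neq_ltn.
  exact: tree_adj_level G_tree (levP v) (levP w) vw.
- move=> u v w /= /andP[uw ltuw] /andP[vw ltvw].
  apply: (acyclic_nbr_inj acG (levP w) (levP u) (levP v));
    by rewrite 1?adj_sym// ltnW.
move=> v w /= /andP[vw ltvw].
have lw : lev w = (lev v).+1.
  by apply/eqP; rewrite eqn_leq ltvw (at_dist_adj (levP v) (levP w) vw).
have /andP[_ dv] := degE v; have /andP[dw _] := degE w.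
rewrite lw in dw.
have dv2 : (deg v)%:R <= 2 * (k (lev v))%:R :> R.
  rewrite -natrM ler_nat mul2n -addnn (leq_trans dv)// -addn1 leq_add2l.
  exact: k_gt0.
have dw' : (k (lev v).+1)%:R <= (deg w)%:R :> R by rewrite ler_nat.
have := kC (lev v); have : 0 <= (deg w)%:R :> R by [].
by nra.
Qed.
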